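(* Let $0<\rho<1/3$ and $\rho\le\lambda\le 1-2\rho$, and let $E_{\rho,\lambda}\subset\mathbb{R}$ be the self-similar set generated by $\varphi_1(x)=\rho x$, $\varphi_2(x)=\rho x+\lambda$, $\varphi_3(x)=\rho x+1-\rho$. Let $f$ be a contractive similitude on $\mathbb{R}$ such that $f(E_{\rho,\lambda})\subset E_{\rho,\lambda}$. (i) If $\lambda\ne(1-\rho)/2$, then there exists a finite word $\mathbf{i}\in\Omega_3^*$ such that $f(x)=\varphi_{\mathbf{i}}(x)$ for all $x\in\mathbb{R}$. (ii) If $\lambda=(1-\rho)/2$, then there exists a finite word $\mathbf{i}\in\Omega_3^*$ such that $f(x)=\varphi_{\mathbf{i}}(x)$ for all $x\in\mathbb{R}$ or $f(x)=\varphi_{\mathbf{i}}(1-x)$ for all $x\in\mathbb{R}$.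
   Context: A contractive similitude on $\mathbb{R}$ is a map $f(x)=rx+t$ with $0<|r|<1$ and $t\in\mathbb{R}$. The self-similar set generated by contractive similitudes $\varphi_1,\varphi_2,\varphi_3$ is the unique non-empty compact set $E\subset\mathbb{R}$ with $E=\varphi_1(E)\cup\varphi_2(E)\cup\varphi_3(E)$. $\Omega_3^*$ is the set of all finite words over the alphabet $\{1,2,3\}$, including the empty word. For $\mathbf{i}=i_1i_2\ldots i_n\in\Omega_3^*$, $\varphi_{\mathbf{i}}:=\varphi_{i_1}\circ\varphi_{i_2}\circ\cdots\circ\varphi_{i_n}$, and $\varphi_{\emptyset}$ is the identity map. *)

(* Defs.v *)
From HB Require Import structures.
From mathcomp Require Import all_boot all_order all_algebra.
From mathcomp Require Import all_classical all_reals all_analysis.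
Set Implicit Arguments.
Unset Strict Implicit.
Unset Printing Implicit Defensive.
Import Order.TTheory GRing.Theory Num.Theory.
Import numFieldNormedType.Exports.
Local Open Scope classical_set_scope.
Local Open Scope ring_scope.

Definition contractive_similitude (R : realType) (f : R -> R) : Prop :=
  exists r t : R, [/\ 0 < `|r|, `|r| < 1 & forall x, f x = r * x + t].

(* By Hutchinson's theorem, exactly one set [E] satisfies this predicate
   when each [phi i] is a contractive similitude. *)
Definition is_self_similar_set (R : realType) (phi : 'I_3 -> R -> R)
    (E : set R) : Prop :=
  [/\ E !=set0, compact E & E = \bigcup_(i in [set: 'I_3]) (phi i @` E)].

(* The letters 1, 2, 3 are the ordinals 0, 1, 2 of ['I_3]. *)
Definition phi (R : realType) (rho lambda : R) (i : 'I_3) (x : R) : R :=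
  rho * x + tnth [tuple 0; lambda; 1 - rho] i.

Definition phi_word (R : realType) (rho lambda : R) (w : seq 'I_3) : R -> R :=
  foldr (fun i g => phi rho lambda i \o g) idfun w.

(* Main.v *)
Require Import Defs.
From HB Require Import structures.
From mathcomp Require Import all_boot all_order all_algebra.
From mathcomp Require Import all_classical all_reals all_analysis.
From mathcomp Require Import ring lra.
Set Implicit Arguments.
Unset Strict Implicit.
Unset Printing Implicit Defensive.
Import Order.TTheory GRing.Theory Num.Theory.
Import numFieldNormedType.Exports.
Local Open Scope classical_set_scope.
Local Open Scope ring_scope.

(* The set [E] lies in three intervals separated by the gaps
   (rho, lambda) and (lambda + rho, 1 - rho); up to the reflection x -> 1 - x the
   left gap is not the longer one. It suffices to show that a self-embedding
   f(x) = q x + t with |q| < 1 maps [E] into one piece phi_i(E): then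
   phi_i^{-1} o f is again a self-embedding, of ratio q / rho, and the process
   stops at an isometry, x or 1 - x, the latter being possible only if the gaps
   are equal. The image f(E) cannot straddle the longest gap of [E], which
   settles the case of equal gaps. Otherwise f(E) may only straddle the left
   gap; one takes the smallest n with such an f for which |q| >= rho^n. If all
   self-embeddings of ratio q straddle the left gap, comparing f with the maps
   phi_j^{-1} o f o phi_i of the same ratio gives a contradiction. If one does
   not, then q is a power of rho by the choice of n, and the position of the
   longest gaps of f(E) next to the left gap of [E] gives a contradiction. *)

(** * Contraction estimates *)

Lemma exists_expr_lt (R : realType) (r e : R) :
  0 < r -> r < 1 -> 0 < e -> exists n, r ^+ n < e.
Proof.
move=> r0 r1 e0; have /cvg_expr/cvgr0Pnorm_lt/(_ e e0)[n _ /(_ n)] : `|r| < 1.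
  by rewrite ger0_norm// ltW.
by rewrite /= leqnn => /(_ isT) rn; exists n; apply: le_lt_trans rn; exact: ler_norm.
Qed.

(* [P] is mapped into itself by [t |-> (t - d) / rho], which expands away from
   its fixed point. *)
Lemma bounded_expanding_orbit (R : realType) (rho c d : R) (P : R -> Prop) :
  0 < rho -> rho < 1 -> c = rho * c + d -> 0 <= c <= 1 ->
  (forall t, P t -> 0 <= t <= 1) ->
  (forall t, P t -> exists t', P t' /\ t = rho * t' + d) ->
  forall t, P t -> t = c.
Proof.
move=> r0 r1 cE c01 P01 Pstep t Pt; apply/eqP; case: eqP => // /eqP tc.
have bnd n : forall s, P s -> `|s - c| <= rho ^+ n.
  elim: n => [|n IH] s Ps.
    by have := P01 _ Ps; rewrite expr0 ler_norml; lra.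
  have [s' [/IH Ps' ->]] := Pstep _ Ps.
  have -> : rho * s' + d - c = rho * (s' - c) by rewrite {1}cE; ring.
  by rewrite normrM gtr0_norm// exprS ler_pM2l.
have tc0 : 0 < `|t - c| by rewrite normr_gt0 subr_eq0.
by have [n] := exists_expr_lt r0 r1 tc0; rewrite ltNge bnd.
Qed.

(** * Elementary properties of the self-similar set *)

(** Compactness is replaced by its consequence that [E] has extreme points 0 and 1; the resulting
    list of properties is stable under reflection. *)
Record cantor3 (R : realType) (rho lambda : R) (E : set R) : Prop := Cantor3 {
  cantor3_rho_gt0 : 0 < rho;
  cantor3_rho_lt : rho < 1 / 3;
  cantor3_lambda_ge : rho <= lambda;
  cantor3_lambda_le : lambda <= 1 - 2 * rho;
  cantor3_itv : forall x, E x -> 0 <= x <= 1;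
  cantor3_0 : E 0;
  cantor3_1 : E 1;
  cantor3_mapl : forall x, E x -> E (rho * x);
  cantor3_mapm : forall x, E x -> E (rho * x + lambda);
  cantor3_mapr : forall x, E x -> E (rho * x + (1 - rho));
  cantor3_inv : forall x, E x -> exists2 y, E y &
    [\/ x = rho * y, x = rho * y + lambda | x = rho * y + (1 - rho)] }.

Lemma phiE (R : realType) (rho lambda x : R) (i : 'I_3) :
  phi rho lambda i x =
  rho * x + (if i == 0 :> nat then 0 else if i == 1 :> nat then lambda
             else 1 - rho).
Proof.
by rewrite /phi; case: i => -[|[|[|//]]] lti; rewrite (tnth_nth 0).
Qed.

Lemma self_similar_cantor3 (R : realType) (rho lambda : R) (E : set R) :
  0 < rho -> rho < 1 / 3 -> rho <= lambda -> lambda <= 1 - 2 * rho ->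
  is_self_similar_set (phi rho lambda) E -> cantor3 rho lambda E.
Proof.
move=> r0 r3 rl lr [E0 cE EE].
have Emap i x : E x -> E (phi rho lambda i x).
  by move=> Ex; rewrite EE; exists i => //; exists x.
have mapl x : E x -> E (rho * x).
  by move=> /(Emap ord0); rewrite phiE /= addr0.
have mapm x : E x -> E (rho * x + lambda).
  by move=> /(Emap (inord 1)); rewrite phiE inordK.
have mapr x : E x -> E (rho * x + (1 - rho)).
  by move=> /(Emap (inord 2)); rewrite phiE inordK.
have inv x : E x -> exists2 y, E y &
    [\/ x = rho * y, x = rho * y + lambda | x = rho * y + (1 - rho)].
  rewrite {1}EE => -[[m lt_m] _ [y Ey <-]]; exists y => //.
  rewrite phiE /=; case: m lt_m => [|[|m]] _ /=; rewrite ?addr0.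
  - by constructor 1.
  - by constructor 2.
  - by constructor 3.
have cid : {within E, continuous (@idfun R)}.
  by apply: continuous_subspaceT => x; exact: cvg_id.
have [M EM maxM] := compact_EVT_max E0 cE cid.
have [m Em minm] := compact_EVT_min E0 cE cid.
rewrite inE in EM; rewrite inE in Em.
have {}maxM x : E x -> x <= M by move=> Ex; apply: maxM; rewrite inE.
have {}minm x : E x -> m <= x by move=> Ex; apply: minm; rewrite inE.
(* The minimum is the fixed point of the leftmost map and the maximum that of the rightmost one. *)
have m0 : m = 0.
  have [y /minm ym yE] := inv _ Em; have := minm _ (mapl _ Em).
  by case: yE; nra.
have M1 : M = 1.
  have [y /maxM ym yE] := inv _ EM; have := maxM _ (mapr _ EM).
  by case: yE; nra.
split=> //; [|by rewrite -m0|by rewrite -M1].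
by move=> x Ex; rewrite -{1}m0 -M1 maxM// minm.
Qed.

(** The reflection exchanges the two first-level gaps, so the left one may be taken as the
    shorter. *)
Lemma cantor3_reflect (R : realType) (rho lambda : R) (E : set R) :
  cantor3 rho lambda E ->
  cantor3 rho (1 - rho - lambda) [set x | E (1 - x)].
Proof.
case=> r0 r3 rl lr itv E0 E1 mapl mapm mapr inv; split=> //=; try lra.
- by move=> x /itv; lra.
- by rewrite subr0.
- by rewrite subrr.
- by move=> x /mapr; congr E; ring.
- by move=> x /mapm; congr E; ring.
- by move=> x /mapl; congr E; ring.
- move=> x /inv[y Ey yE]; exists (1 - y); first by congr E: Ey; ring.
  by case: yE => yE; [constructor 3|constructor 2|constructor 1]; lra.
Qed.

(** * First-level pieces and cylinders *)

Section SelfEmbeddings.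
Variable R : realType.
Implicit Types (rho lambda a b c d e q t x y : R) (E : set R) (n : nat).

Lemma cantor3_endpoints rho lambda E : cantor3 rho lambda E ->
  [/\ E rho, E lambda, E (lambda + rho) & E (1 - rho)].
Proof.
case=> _ _ _ _ _ E0 E1 /(_ _ E1) + mapm /(_ _ E0) + _.
have := mapm _ E1; have := mapm _ E0.
by rewrite !mulr0 !mulr1 !add0r addrC.
Qed.

Lemma cantor3_scale rho lambda E y : cantor3 rho lambda E -> E y ->
  0 <= rho * y <= rho.
Proof.
move=> cE /(cantor3_itv cE)/andP[y0 y1]; have r0 := ltW (cantor3_rho_gt0 cE).
by rewrite mulr_ge0// ler_piMr.
Qed.

Lemma left_piece rho lambda E x : cantor3 rho lambda E -> E x -> x <= rho ->
  exists2 y, E y & x = rho * y.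
Proof.
move=> cE Ex xr; have [r0 r3 rl lr _ _ E1 _ _ _ inv] := cE.
have [y Ey yE] := inv _ Ex; have := cantor3_scale cE Ey.
case: yE => xE y01; first by exists y.
(* The left and middle intervals touch if [lambda = rho]; the common point is [rho * 1]. *)
- by exists 1; [exact: E1|lra].
- by exfalso; lra.
Qed.

Lemma middle_piece rho lambda E x : cantor3 rho lambda E -> E x ->
  lambda < 1 - 2 * rho -> lambda <= x <= lambda + rho ->
  exists2 y, E y & x = rho * y + lambda.
Proof.
move=> cE Ex lr' xl; have [r0 r3 rl lr _ E0 _ _ _ _ inv] := cE.
have [y Ey yE] := inv _ Ex; have := cantor3_scale cE Ey.
case: yE => xE y01.
- by exists 0; [exact: E0|lra].
- by exists y.
- by exfalso; lra.
Qed.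

Lemma right_piece rho lambda E x : cantor3 rho lambda E -> E x ->
  lambda < 1 - 2 * rho -> 1 - rho <= x ->
  exists2 y, E y & x = rho * y + (1 - rho).
Proof.
move=> cE Ex lr' xl; have [r0 r3 rl lr _ _ _ _ _ _ inv] := cE.
have [y Ey yE] := inv _ Ex; have := cantor3_scale cE Ey.
by case: yE => xE y01; [exfalso; lra|exfalso; lra|exists y].
Qed.

Lemma left_gap rho lambda E x : cantor3 rho lambda E -> E x ->
  x <= rho \/ lambda <= x.
Proof.
move=> cE Ex; have [r0 r3 rl lr _ _ _ _ _ _ inv] := cE.
have [y Ey yE] := inv _ Ex; have := cantor3_scale cE Ey.
by case: yE => xE y01; [left|right|right]; lra.
Qed.

Lemma right_gap rho lambda E x : cantor3 rho lambda E -> E x ->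
  x <= lambda + rho \/ 1 - rho <= x.
Proof.
move=> cE Ex; have [r0 r3 rl lr _ _ _ _ _ _ inv] := cE.
have [y Ey yE] := inv _ Ex; have := cantor3_scale cE Ey.
by case: yE => xE y01; [left|left|right]; lra.
Qed.

Lemma cantor3_expr_le1 rho lambda E n : cantor3 rho lambda E ->
  0 < rho ^+ n <= 1.
Proof.
case=> r0 r3 *; rewrite exprn_gt0//= exprn_ile1//; last by lra.
exact: ltW.
Qed.

Lemma left_cylinder rho lambda E n x : cantor3 rho lambda E -> E x ->
  x <= rho ^+ n -> exists2 y, E y & x = rho ^+ n * y.
Proof.
move=> cE; have r0 := cantor3_rho_gt0 cE.
elim: n x => [|n IH] x Ex; first by exists x => //; rewrite expr0 mul1r.
have /andP[_ r1] := cantor3_expr_le1 n cE; rewrite exprS => xr.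
have [|y Ey yE] := left_piece cE Ex; first nra.
have [|z Ez zE] := IH y Ey; first by rewrite yE ler_pM2l in xr.
by exists z => //; rewrite yE zE mulrA.
Qed.

Lemma right_cylinder rho lambda E n x : cantor3 rho lambda E -> E x ->
  lambda < 1 - 2 * rho -> 1 - rho ^+ n <= x ->
  exists2 y, E y & x = rho ^+ n * y + (1 - rho ^+ n).
Proof.
move=> cE + lr; have r0 := cantor3_rho_gt0 cE.
elim: n x => [|n IH] x Ex; first by exists x => //; rewrite expr0; ring.
have /andP[_ r1] := cantor3_expr_le1 n cE; rewrite exprS => xr.
have [|y Ey yE] := right_piece cE Ex lr; first nra.
have [|z Ez zE] := IH y Ey; first by rewrite yE in xr; nra.
by exists z => //; rewrite yE zE; ring.
Qed.

(** * Gaps and their lengths *)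

(** The ends need not lie in [E], so this may be part of a longer complementary interval. *)
Definition gap E a b := forall x, E x -> x <= a \/ b <= x.

(* The endpoints of the first-level intervals lie in [E], so a gap lies in one
   of these intervals, where it can be magnified, or in a first-level gap. *)
Lemma gap_cases rho lambda E a b : cantor3 rho lambda E ->
  0 <= a -> a < b -> b <= 1 -> gap E a b ->
  [\/ exists c e, [/\ 0 <= c, c < e, e <= 1, gap E c e & b - a = rho * (e - c)],
      b - a <= lambda - rho |
      lambda + rho <= a /\ b <= 1 - rho].
Proof.
move=> cE a0 ab b1 gab.
have [r0 r3 rl lr _ _ _ mapl mapm mapr _] := cE.
have [E_r E_l E_lr E_1r] := cantor3_endpoints cE.
have zoom d : (forall x, E x -> E (rho * x + d)) -> d <= a -> b <= rho + d ->
    exists c e, [/\ 0 <= c, c < e, e <= 1, gap E c e & b - a = rho * (e - c)].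
  move=> Ed da bd; have rn0 : rho != 0 by rewrite gt_eqF.
  exists ((a - d) / rho), ((b - d) / rho); split.
  - by rewrite divr_ge0 ?subr_ge0// ltW.
  - by rewrite ltr_pM2r ?invr_gt0// ltrD2r.
  - by rewrite ler_pdivrMr// mul1r lerBlDr.
  - move=> x /Ed/gab; rewrite ler_pdivlMr// ler_pdivrMr//.
    by rewrite lerBrDr lerBlDr [x * rho]mulrC.
  - by field.
have [ra|br] := gab _ E_r; last first.
  by constructor 1; apply: (zoom 0); [move=> x /mapl; rewrite addr0|lra|lra].
have [la|bl] := gab _ E_l; last by constructor 2; lra.
have [la'|bl'] := gab _ E_lr; last first.
  by constructor 1; apply: (zoom lambda); [exact: mapm|lra|lra].
have [la''|bl''] := gab _ E_1r; last by constructor 3.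
by constructor 1; apply: (zoom (1 - rho)); [exact: mapr|lra|lra].
Qed.

(* [2 * lambda <= 1 - rho] says that the left first-level gap, of length
   [lambda - rho], is at most as long as the right one. *)
Lemma gap_length rho lambda E a b : cantor3 rho lambda E ->
  2 * lambda <= 1 - rho -> 0 <= a -> b <= 1 -> gap E a b ->
  b - a <= 1 - 2 * rho - lambda.
Proof.
move=> cE gl a0 b1 gab; have [r0 r3 rl lr *] := cE.
case: (ltP a b) => [ab|]; last by lra.
(* A gap shorter than both first-level ones can be magnified by [1 / rho] within [0, 1]; after n
   magnifications its length is at most [rho ^+ n]. *)
have bnd n : forall c e, 0 <= c -> c < e -> e <= 1 -> gap E c e ->
    e - c <= 1 - 2 * rho - lambda \/ e - c <= rho ^+ n.
  elim: n => [|n IH] c e c0 ce e1 gce; first by right; rewrite expr0; lra.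
  have [[c' [e' [c'0 ce' e'1 gce' ->]]]|h|[h1 h2]] := gap_cases cE c0 ce e1 gce.
  - have [h|h] := IH _ _ c'0 ce' e'1 gce'; first by left; nra.
    by right; rewrite exprS ler_pM2l.
  - by left; lra.
  - by left; lra.
have g0 : 0 < 1 - 2 * rho - lambda by lra.
have r1 : rho < 1 by lra.
have [n rn] := exists_expr_lt r0 r1 g0.
by have [] := bnd n _ _ a0 ab b1 gab; lra.
Qed.

(** A gap inside a first-level interval is shrunk by [rho], and the left gap is strictly shorter, so
    only the right gap attains the maximal length. *)
Lemma longest_gap rho lambda E a b : cantor3 rho lambda E ->
  2 * lambda < 1 - rho -> 0 <= a -> b <= 1 -> gap E a b ->
  1 - 2 * rho - lambda <= b - a -> a = lambda + rho /\ b = 1 - rho.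
Proof.
move=> cE gl a0 b1 gab long; have [r0 r3 rl lr *] := cE.
have ab : a < b by lra.
have [[c [e [c0 ce e1 gce abE]]]|h|[h1 h2]] := gap_cases cE a0 ab b1 gab.
- by have := gap_length cE (ltW gl) c0 e1 gce; nra.
- by lra.
- by split; lra.
Qed.

(** * Self-embeddings and division by a piece *)

Definition self_embedding E q t := forall x, E x -> E (q * x + t).

(* [x |-> q * x + t] maps [E] into a single first-level piece. *)
Definition factors rho lambda E q t := exists q' t',
  [/\ q = rho * q', self_embedding E q' t' &
      [\/ t = rho * t', t = rho * t' + lambda | t = rho * t' + (1 - rho)]].

Lemma self_embedding_piece rho E q t d : 0 < rho ->
  (forall x, E x -> exists2 y, E y & rho * q * x + t = rho * y + d) ->
  exists2 t', self_embedding E q t' & t = rho * t' + d.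
Proof.
move=> r0 piece; have rn0 : rho != 0 by rewrite gt_eqF.
exists ((t - d) / rho); last by field.
move=> x /piece[y Ey h]; suff -> : q * x + (t - d) / rho = y by [].
apply: (mulfI rn0); apply: (addIr d); rewrite -h; field.
exact: rn0.
Qed.

Lemma self_embedding_left rho lambda E q t : cantor3 rho lambda E ->
  self_embedding E (rho * q) t ->
  (forall x, E x -> rho * q * x + t <= rho) ->
  exists2 t', self_embedding E q t' & t = rho * t'.
Proof.
move=> cE emb le_r.
have [x Ex|t' embt' tE] := @self_embedding_piece rho E q t 0 (cantor3_rho_gt0 cE).
  have [y Ey ->] := left_piece cE (emb _ Ex) (le_r _ Ex).
  by exists y => //; rewrite addr0.
by exists t' => //; rewrite tE addr0.
Qed.

Lemma self_embedding_middle rho lambda E q t : cantor3 rho lambda E ->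
  lambda < 1 - 2 * rho -> self_embedding E (rho * q) t ->
  (forall x, E x -> lambda <= rho * q * x + t <= lambda + rho) ->
  exists2 t', self_embedding E q t' & t = rho * t' + lambda.
Proof.
move=> cE lr emb le_r; apply: self_embedding_piece (cantor3_rho_gt0 cE) _ => x Ex.
exact: (middle_piece cE (emb _ Ex) lr (le_r _ Ex)).
Qed.

Lemma self_embedding_right rho lambda E q t : cantor3 rho lambda E ->
  lambda < 1 - 2 * rho -> self_embedding E (rho * q) t ->
  (forall x, E x -> 1 - rho <= rho * q * x + t) ->
  exists2 t', self_embedding E q t' & t = rho * t' + (1 - rho).
Proof.
move=> cE lr emb le_r; apply: self_embedding_piece (cantor3_rho_gt0 cE) _ => x Ex.
exact: (right_piece cE (emb _ Ex) lr (le_r _ Ex)).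
Qed.

Lemma piece_factors rho lambda E q t : cantor3 rho lambda E ->
  lambda < 1 - 2 * rho -> self_embedding E q t ->
  [\/ forall x, E x -> q * x + t <= rho,
      forall x, E x -> lambda <= q * x + t <= lambda + rho |
      forall x, E x -> 1 - rho <= q * x + t] -> factors rho lambda E q t.
Proof.
move=> cE lr; have r0 := cantor3_rho_gt0 cE.
have : q = rho * (q / rho) by field; rewrite gt_eqF.
move: (q / rho) => q' -> emb [le_r|le_r|le_r].
- have [t' embt' tE] := self_embedding_left cE emb le_r.
  by exists q', t'; split=> //; constructor 1.
- have [t' embt' tE] := self_embedding_middle cE lr emb le_r.
  by exists q', t'; split=> //; constructor 2.
- have [t' embt' tE] := self_embedding_right cE lr emb le_r.
  by exists q', t'; split=> //; constructor 3.
Qed.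

(* The image of [E] has no gap as long as the right one, since [`|q| < 1]. *)
Lemma image_avoids_right_gap rho lambda E q t : cantor3 rho lambda E ->
  2 * lambda <= 1 - rho -> q != 0 -> `|q| < 1 -> self_embedding E q t ->
  (forall x, E x -> q * x + t <= lambda + rho) \/
  (forall x, E x -> 1 - rho <= q * x + t).
Proof.
move=> cE gl q0 q1 emb; have [r0 r3 rl lr *] := cE.
apply: contrapT => /not_orP[].
move=> /existsNP[x /not_implyP[Ex /negP]]; rewrite -ltNge => xl.
move=> /existsNP[y /not_implyP[Ey /negP]]; rewrite -ltNge => yr.
have {}xl : 1 - rho <= q * x + t by have [] := right_gap cE (emb _ Ex); lra.
have {}yr : q * y + t <= lambda + rho.
  by have [] := right_gap cE (emb _ Ey); lra.
have := cantor3_itv cE Ex; have := cantor3_itv cE Ey => /andP[y0 y1] /andP[x0 x1].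
(* The preimages of the ends of the right gap bound a gap of [E] longer by the factor [1 / |q|],
   against [gap_length]. *)
have [c qc] : exists c, q * c + t = lambda + rho.
  by exists ((lambda + rho - t) / q); field.
have [e qe] : exists e, q * e + t = 1 - rho.
  by exists ((1 - rho - t) / q); field.
have gap_qE z : E z -> q * z + t <= q * c + t \/ q * e + t <= q * z + t.
  by move=> /emb/(right_gap cE); rewrite qc qe.
move: xl yr q1; rewrite -qe -qc !lerD2r ltr_norml => xl yr /andP[q1 q1'].
case: (ltgtP q 0) q0 => // qs _.
- rewrite !ler_nM2l// in xl yr.
  have gec : gap E e c.
    by move=> z /gap_qE; rewrite !lerD2r !ler_nM2l//; case; auto.
  by have := gap_length cE gl (le_trans x0 xl) (le_trans yr y1) gec; nra.
- rewrite !ler_pM2l// in xl yr.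
  have gec : gap E c e.
    by move=> z /gap_qE; rewrite !lerD2r !ler_pM2l//; case; auto.
  by have := gap_length cE gl (le_trans y0 yr) (le_trans xl x1) gec; nra.
Qed.

(** * Images straddling the left gap when it is the shorter one *)

Lemma self_embedding_comp rho E q t d : (forall x, E x -> E (rho * x + d)) ->
  self_embedding E q t -> self_embedding E (rho * q) (q * d + t).
Proof.
move=> Ed emb x /Ed/emb; congr E; ring.
Qed.

Lemma power_ratio_factors rho lambda E n t : cantor3 rho lambda E ->
  2 * lambda < 1 - rho -> self_embedding E (rho ^+ n.+1) t ->
  factors rho lambda E (rho ^+ n.+1) t.
Proof.
move=> cE gl emb; have [r0 r3 rl lr itv E0 E1 _ _ _ _] := cE.
have lr' : lambda < 1 - 2 * rho by lra.
have /andP[q0 q1] := cantor3_expr_le1 n cE.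
apply: contrapT => nfact.
set q := rho ^+ n in q0 q1.
have rq : rho ^+ n.+1 = rho * q by rewrite exprS.
rewrite rq in emb nfact.
have rq0 : 0 < rho * q by rewrite mulr_gt0.
have rqr : rho * q <= rho by nra.
have qn0 : q != 0 by rewrite gt_eqF.
have rn0 : rho != 0 by rewrite gt_eqF.
have q1' : `|rho * q| < 1 by rewrite ger0_norm; lra.
have [le_lr|ge_r] := image_avoids_right_gap cE (ltW gl) (lt0r_neq0 rq0) q1' emb;
  last by apply: nfact; apply: piece_factors => //; constructor 3.
have tl : t < lambda.
  rewrite ltNge; apply/negP => lt; apply: nfact; apply: piece_factors => //.
  constructor 2 => x Ex; rewrite le_lr// andbT (le_trans lt)// lerDr.
  by have /andP[x0 _] := itv _ Ex; rewrite mulr_ge0// ltW.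
have tr : rho < rho * q + t.
  rewrite ltNge; apply/negP => rt; apply: nfact; apply: piece_factors => //.
  constructor 1 => x Ex; apply: le_trans rt; rewrite lerD2r.
  by have /andP[_ x1] := itv _ Ex; rewrite ler_piMr// ltW.
have t_le : t <= rho.
  by have := emb _ E0; rewrite mulr0 add0r => /(left_gap cE)[//|]; lra.
have t_ge : lambda <= rho * q + t.
  by have := emb _ E1; rewrite mulr1 => /(left_gap cE)[|//]; lra.
(* Seen at scale [rho * q], [E] looks like a copy of [E] ending at [rho]
   followed, after a gap [g], by a copy starting at [lambda]; the image of [E]
   is a translate of these copies, [u] being the offset from the left one. *)
have [u uE] : exists u, rho * q * u = t - rho + rho * q.
  by exists ((t - rho + rho * q) / (rho * q)); field; rewrite qn0 rn0.
have [g gE] : exists g, rho * q * g = lambda - rho.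
  by exists ((lambda - rho) / (rho * q)); field; rewrite qn0 rn0.
have u0 : 0 < u by rewrite -(pmulr_rgt0 _ rq0) uE; lra.
have u1 : u <= 1 by rewrite -(ler_pM2l rq0) uE; lra.
have g0 : 0 <= g by rewrite -(pmulr_rge0 _ rq0) gE; lra.
have left_copy x : E x -> x + u <= 1 -> E (x + u).
  move=> Ex xu; have := emb _ Ex.
  have -> : rho * q * x + t = rho * (q * (x + u) + (1 - q)).
    by lra.
  move=> /(left_piece cE)[|y Ey]; first by rewrite -{2}[rho]mulr1 ler_pM2l//; nra.
  move=> /(mulfI (lt0r_neq0 r0)) yE; rewrite -yE in Ey.
  have [|w Ew] := right_cylinder cE Ey lr' (_ : 1 - q <= _).
    by have /andP[x0 _] := itv _ Ex; rewrite lerDr mulr_ge0; lra.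
  by move=> /addIr/(mulfI qn0) ->.
have right_copy x : E x -> lambda <= rho * q * x + t -> E (x + u - 1 - g).
  move=> Ex lx; have := emb _ Ex.
  have := le_lr _ Ex; move: lx.
  have -> : rho * q * x + t = rho * (q * (x + u - 1 - g)) + lambda by lra.
  move=> lx xl /(middle_piece cE)[//||y Ey]; first by rewrite lx.
  move=> /addIr/(mulfI (lt0r_neq0 r0)) yE; rewrite -yE in Ey.
  have [|w Ew] := left_cylinder cE Ey (_ : _ <= q).
    by have /andP[_ x1] := itv _ Ex; rewrite ler_piMr//; lra.
  by move=> /(mulfI qn0) ->.
have Eu : E u by have := left_copy _ E0; rewrite add0r; apply.
(* First case: the right gap of the left copy pulls back to a gap of maximal length, which forces
   [u = 0]. *)
have [u_le|u_ge] := right_gap cE Eu.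
  have gap_u : gap E (lambda + rho - u) (1 - rho - u).
    move=> x Ex; case: (leP (x + u) 1) => xu; last by right; lra.
    by have [?|?] := right_gap cE (left_copy _ Ex xu); [left|right]; lra.
  have a0 : 0 <= lambda + rho - u by lra.
  have b1 : 1 - rho - u <= 1 by lra.
  by have [] := longest_gap cE gl a0 b1 gap_u; lra.
have Eug : E (u - g).
  have := right_copy _ E1; rewrite mulr1 => /(_ t_ge); congr E; ring.
(* Now [u] and [u - g] lie on opposite sides of the right gap, so the pulled-back left gap, of
   length [g], is a longest one. This gives [u = 1 - lambda - rho], too small. *)
have [ug|ug] := right_gap cE Eug.
  have gap_u : gap E (1 - u) (1 + g - u).
    move=> x Ex; have [h|h] := left_gap cE (emb _ Ex).
      by left; rewrite -(ler_pM2l rq0); lra.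
    by right; have /itv := right_copy _ Ex h; lra.
  have /andP[ug0 _] := itv _ Eug.
  have a0 : 0 <= 1 - u by lra.
  have b1 : 1 + g - u <= 1 by lra.
  by have [] := longest_gap cE gl a0 b1 gap_u; lra.
(* Last case: the right gap of the right copy pulls back to a longest gap, so [u = 1 + g], that is
   [t = lambda]. *)
have gap_u : gap E (1 + g + lambda + rho - u) (1 + g + (1 - rho) - u).
  move=> x Ex; have [h|h] := left_gap cE (emb _ Ex).
    have : x <= 1 - u by rewrite -(ler_pM2l rq0); lra.
    by left; lra.
  by have [?|?] := right_gap cE (right_copy _ Ex h); [left|right]; lra.
have a0 : 0 <= 1 + g + lambda + rho - u by lra.
have b1 : 1 + g + (1 - rho) - u <= 1 by lra.
have [|uE' _] := longest_gap cE gl a0 b1 gap_u; first by lra.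
have uE2 : u = 1 + g by lra.
by rewrite uE2 in uE; lra.
Qed.

(* If no self-embedding of ratio [q] factors, each of them has points on both
   sides of the left gap, so that two of them differ by a translation smaller
   than [`|q|]. Hence of the three maps [f \o phi i] two land in different
   pieces and the third crosses the gap; undoing the pieces gives new
   self-embeddings of ratio [q], whose translation parts must be the fixed
   points of expanding maps. *)
Lemma no_self_embedding_of_crossing_ratio rho lambda E q t : cantor3 rho lambda E ->
  2 * lambda < 1 - rho -> q != 0 -> `|q| < 1 ->
  (forall s, self_embedding E q s -> ~ factors rho lambda E q s) ->
  ~ self_embedding E q t.
Proof.
move=> cE gl q0 q1 nfact embt; have [r0 r3 rl lr itv E0 E1 mapl mapm mapr _] := cE.
have lr' : lambda < 1 - 2 * rho by lra.
have mapl0 x : E x -> E (rho * x + 0) by move=> /mapl; rewrite addr0.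
have [_ E_l E_lr E_1r] := cantor3_endpoints cE.
have le_lr s x : self_embedding E q s -> E x -> q * x + s <= lambda + rho.
  move=> emb Ex; have [|ge_r] := image_avoids_right_gap cE (ltW gl) q0 q1 emb.
    exact.
  by case: (nfact _ emb); apply: piece_factors => //; constructor 3.
have lt_l s : self_embedding E q s -> exists2 x, E x & q * x + s < lambda.
  move=> emb; apply: contrapT => h; case: (nfact _ emb).
  apply: piece_factors => //; constructor 2 => x Ex; rewrite le_lr// andbT.
  by rewrite leNgt; apply/negP => xl; apply: h; exists x.
have gt_r s : self_embedding E q s -> exists2 x, E x & rho < q * x + s.
  move=> emb; apply: contrapT => h; case: (nfact _ emb).
  apply: piece_factors => //; constructor 1 => x Ex.
  by rewrite leNgt; apply/negP => xl; apply: h; exists x.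
case: (ltgtP q 0) q0 => // {q1} qs _.
- have cross s : self_embedding E q s -> q + s < lambda /\ rho < s.
    move=> emb; have [x /itv x01 xl] := lt_l _ emb.
    by have [y /itv y01 yr] := gt_r _ emb; split; nra.
  have shift s s' : self_embedding E q s -> self_embedding E q s' -> s' - s < - q.
    move=> emb emb'; have [_ sr] := cross _ emb; have [sl _] := cross _ emb'.
    by have := emb _ E0; rewrite mulr0 add0r => /(left_gap cE)[]; lra.
  have step s : self_embedding E q s ->
      [/\ rho < q * lambda + s, exists2 s', self_embedding E q s' & s = rho * s' + lambda &
          exists2 s', self_embedding E q s' & q * (1 - rho) + s = rho * s'].
    move=> emb.
    have emb1 := self_embedding_comp mapl0 emb; rewrite mulr0 add0r in emb1.
    have emb2 := self_embedding_comp mapm emb.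
    have emb3 := self_embedding_comp mapr emb.
    have piece2 x : E x -> lambda <= q * (lambda + rho) + s ->
        lambda <= rho * q * x + (q * lambda + s) <= lambda + rho.
      move=> Ex h; have := le_lr _ _ emb (mapm _ Ex).
      by have := itv _ Ex => x01; have := cantor3_scale cE Ex; nra.
    have piece1 x : E x -> lambda <= q * rho + s ->
        lambda <= rho * q * x + s <= lambda + rho.
      move=> Ex h; have := le_lr _ _ emb (mapl _ Ex).
      by have := cantor3_scale cE Ex; nra.
    (* Otherwise the images of the left and middle pieces both land in the middle piece; undoing it
       gives translations differing by [- q * lambda / rho], at least [- q], against [shift]. *)
    have y3 : q * (lambda + rho) + s <= rho.
      have [//|y3] := left_gap cE (emb _ E_lr).
      have [s2 embs2 s2E] := self_embedding_middle cE lr' emb2 (fun x Ex => piece2 x Ex y3).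
      have y1 : lambda <= q * rho + s by nra.
      have [s1 embs1 s1E] := self_embedding_middle cE lr' emb1 (fun x Ex => piece1 x Ex y1).
      by have := shift _ _ embs2 embs1; nra.
    have piece3 x : E x -> rho * q * x + (q * (1 - rho) + s) <= rho.
      move=> Ex; have := cantor3_scale cE Ex; nra.
    have [s3 embs3 s3E] := self_embedding_left cE emb3 piece3.
    (* Otherwise the images of the middle and right pieces both land in the left piece, again
       against [shift]. *)
    have y2 : rho < q * lambda + s.
      rewrite ltNge; apply/negP => y2.
      have [|s2 embs2 s2E] := self_embedding_left cE emb2.
        by move=> x Ex; have := cantor3_scale cE Ex; nra.
      by have := shift _ _ embs3 embs2; nra.
    split=> //; last by exists s3.
    have y2' : lambda <= q * lambda + s.
      by have [] := left_gap cE (emb _ E_l); lra.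
    have y1 : lambda <= q * rho + s by nra.
    have [s1 embs1 s1E] := self_embedding_middle cE lr' emb1 (fun x Ex => piece1 x Ex y1).
    by exists s1.
  (* The fixed point of [x |-> rho * x + lambda] is the only possible translation part. *)
  have all_c s : self_embedding E q s -> s = lambda / (1 - rho).
    apply: (@bounded_expanding_orbit R rho _ lambda) => //; first by lra.
    - by field; rewrite subr_eq0 gt_eqF//; lra.
    - by rewrite divr_ge0 ?ler_pdivrMr; lra.
    - by move=> s' /(_ _ E0); rewrite mulr0 add0r => /itv.
    - by move=> s' /step[_ [s1]]; exists s1.
  have [y2 _ [s embs sE]] := step _ embt.
  have tE : t * (1 - rho) = lambda.
    by rewrite (all_c _ embt) divfK// subr_eq0 gt_eqF//; lra.
  have := all_c _ embs; rewrite -(all_c _ embt) => st; rewrite st in sE.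
  have qt : q = - t by nra.
  have y2' : lambda <= q * lambda + t.
    by have [] := left_gap cE (embt _ E_l); lra.
  have t0 : 0 < t by have := embt _ E0; rewrite mulr0 add0r => /itv; nra.
  have lr_eq : lambda = rho.
    by apply/eqP; rewrite eq_le rl andbT -(ler_pM2l t0); nra.
  by rewrite lr_eq in y2 tE; nra.
- have cross s : self_embedding E q s -> s < lambda /\ rho < q + s.
    move=> emb; have [x /itv x01 xl] := lt_l _ emb.
    by have [y /itv y01 yr] := gt_r _ emb; split; nra.
  have shift s s' : self_embedding E q s -> self_embedding E q s' -> s' - s < q.
    move=> emb emb'; have [_ sr] := cross _ emb; have [sl _] := cross _ emb'.
    by have := emb _ E1; rewrite mulr1 => /(left_gap cE)[]; lra.
  have step s : self_embedding E q s ->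
      [/\ lambda <= q * (lambda + rho) + s,
          exists2 s', self_embedding E q s' & s = rho * s' &
          exists2 s', self_embedding E q s' &
            q * (1 - rho) + s = rho * s' + lambda].
    move=> emb.
    have emb1 := self_embedding_comp mapl0 emb; rewrite mulr0 add0r in emb1.
    have emb2 := self_embedding_comp mapm emb.
    have emb3 := self_embedding_comp mapr emb.
    have piece3 x : E x -> lambda <= q * (1 - rho) + s ->
        lambda <= rho * q * x + (q * (1 - rho) + s) <= lambda + rho.
      move=> Ex h; have := le_lr _ _ emb (mapr _ Ex).
      by have := cantor3_scale cE Ex; nra.
    have y2 : q * lambda + s <= rho.
      have [//|y2] := left_gap cE (emb _ E_l).
      have [|s2 embs2 s2E] := self_embedding_middle cE lr' emb2.
        move=> x Ex; have := le_lr _ _ emb (mapm _ Ex).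
        by have := cantor3_scale cE Ex; nra.
      have y4 : lambda <= q * (1 - rho) + s by nra.
      have [s3 embs3 s3E] := self_embedding_middle cE lr' emb3 (fun x Ex => piece3 x Ex y4).
      by have := shift _ _ embs2 embs3; nra.
    have piece1 x : E x -> rho * q * x + s <= rho.
      by move=> Ex; have := cantor3_scale cE Ex; nra.
    have [s1 embs1 s1E] := self_embedding_left cE emb1 piece1.
    have y3 : lambda <= q * (lambda + rho) + s.
      have [y3|//] := left_gap cE (emb _ E_lr).
      have [|s2 embs2 s2E] := self_embedding_left cE emb2.
        by move=> x Ex; have := cantor3_scale cE Ex; nra.
      by have := shift _ _ embs1 embs2; nra.
    split=> //; first by exists s1.
    have y4 : lambda <= q * (1 - rho) + s by nra.
    have [s3 embs3 s3E] := self_embedding_middle cE lr' emb3 (fun x Ex => piece3 x Ex y4).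
    by exists s3.
  have all_0 s : self_embedding E q s -> s = 0.
    apply: (@bounded_expanding_orbit R rho 0 0) => //; try by lra.
    - by move=> s' /(_ _ E0); rewrite mulr0 add0r => /itv.
    - by move=> s' /step[_ [s1]]; exists s1; rewrite addr0.
  have [y3 _ [s embs sE]] := step _ embt.
  (* Here [q * (1 - rho) = lambda] and [lambda <= q * (lambda + rho)], contrary to
     [lambda < 1 - 2 * rho]. *)
  by rewrite (all_0 _ embs) (all_0 _ embt) in sE y3; nra.
Qed.

(** * From factorization to words *)

(** The images of 0 and 1 are in [0, 1] at distance at least 1, hence are its ends. *)
Lemma self_embedding_isometry rho lambda E q t : cantor3 rho lambda E ->
  self_embedding E q t -> 1 <= `|q| -> (q = 1 /\ t = 0) \/ (q = -1 /\ t = 1).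
Proof.
move=> cE emb q1.
have t01 := cantor3_itv cE (emb _ (cantor3_0 cE)).
have qt01 := cantor3_itv cE (emb _ (cantor3_1 cE)).
rewrite mulr0 add0r in t01; rewrite mulr1 in qt01.
by move: q1; case: (ger0P q) => q0 q1; [left|right]; split; lra.
Qed.

Lemma phi_word_ratio rho lambda (w : seq 'I_3) x :
  phi_word rho lambda w x = rho ^+ size w * x + phi_word rho lambda w 0.
Proof.
elim: w => [|i w IH] /=; first by rewrite mul1r addr0.
by rewrite /phi IH exprS; ring.
Qed.

(** Each factorization yields a letter and divides the ratio by [rho], until an isometry remains.
    The bound [rho ^+ n] lets the lemma serve inside the induction that proves factorization. *)
Lemma self_embedding_word rho lambda E n : cantor3 rho lambda E ->
  (forall q t, rho ^+ n <= `|q| -> `|q| < 1 -> self_embedding E q t ->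
     factors rho lambda E q t) ->
  forall q t, rho ^+ n <= `|q| -> self_embedding E q t ->
  exists w, (forall x, q * x + t = phi_word rho lambda w x) \/
    (self_embedding E (-1) 1 /\
     forall x, q * x + t = phi_word rho lambda w (1 - x)).
Proof.
move=> cE; have iso q t : 1 <= `|q| -> self_embedding E q t ->
    exists w, (forall x, q * x + t = phi_word rho lambda w x) \/
      (self_embedding E (-1) 1 /\
       forall x, q * x + t = phi_word rho lambda w (1 - x)).
  move=> q1 emb; exists [::].
  case: (self_embedding_isometry cE emb q1) => -[qE tE]; rewrite qE tE in emb *.
    by left=> x; rewrite /=; ring.
  by right; split=> // x; rewrite /=; ring.
elim: n => [|n IH] fact q t nq emb; first by rewrite expr0 in nq; exact: iso.
case: (leP 1 `|q|) => [q1|q1]; first exact: iso.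
have r0 := cantor3_rho_gt0 cE.
have r1 : rho <= 1 by have := cantor3_rho_lt cE; lra.
have [q' [t' [qE emb' tE]]] := fact _ _ nq q1 emb.
have nq' : rho ^+ n <= `|q'|.
  by move: nq; rewrite qE normrM gtr0_norm// exprS ler_pM2l.
have {}IH : exists w, (forall x, q' * x + t' = phi_word rho lambda w x) \/
    (self_embedding E (-1) 1 /\
     forall x, q' * x + t' = phi_word rho lambda w (1 - x)).
  apply: IH nq' emb' => q'' t'' nq''; apply: fact; apply: le_trans nq''.
  by rewrite exprS ler_piMl// exprn_ge0// ltW.
have [i iE] : exists i : 'I_3, forall x,
    q * x + t = phi rho lambda i (q' * x + t').
  rewrite qE; case: tE => ->; [exists ord0|exists (inord 1)|exists (inord 2)] => x;
    by rewrite phiE ?inordK//=; ring.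
have [w wE] := IH; exists (i :: w).
case: wE => [wE|[emb1 wE]]; [left=> x|right; split=> // x];
  by rewrite iE wE.
Qed.

(** The reflected right gap would be a second longest gap. *)
Lemma no_reflection rho lambda E : cantor3 rho lambda E ->
  2 * lambda < 1 - rho -> ~ self_embedding E (-1) 1.
Proof.
move=> cE gl emb; have [r0 r3 rl lr *] := cE.
have refl_gap : gap E rho (1 - lambda - rho).
  by move=> x /emb/(right_gap cE)[]; [right|left]; lra.
have r0' := ltW r0; have b1 : 1 - lambda - rho <= 1 by lra.
by have [] := longest_gap cE gl r0' b1 refl_gap; lra.
Qed.

Lemma factors_lt rho lambda E n q t : cantor3 rho lambda E ->
  2 * lambda < 1 - rho -> rho ^+ n <= `|q| -> `|q| < 1 ->
  self_embedding E q t -> factors rho lambda E q t.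
Proof.
move=> cE gl; have r0 := cantor3_rho_gt0 cE.
elim: n q t => [|n IH] q t nq q1 emb; first by move: nq; rewrite expr0; lra.
have q0 : q != 0 by rewrite -normr_gt0 (lt_le_trans _ nq)// exprn_gt0.
apply: contrapT => nfact.
(* It remains to treat a factoring [s] of the same ratio: the induction hypothesis makes its
   quotient a word, so [q] is a positive power of [rho]. *)
apply: (no_self_embedding_of_crossing_ratio cE gl q0 q1 _ emb) => s embs facts.
have [q' [t' [qE emb' _]]] := facts.
have nq' : rho ^+ n <= `|q'|.
  by move: nq; rewrite qE normrM gtr0_norm// exprS ler_pM2l.
have [w [wE|[emb1 _]]] := self_embedding_word cE IH nq' emb';
  last by case: (no_reflection cE gl emb1).
have q'E : q' = rho ^+ size w.
  have := wE 1; have := wE 0; rewrite (phi_word_ratio _ _ _ 1); lra.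
rewrite qE q'E -exprS in emb nfact.
by apply: nfact; exact: power_ratio_factors.
Qed.

(** * Equal gaps, reflected words and the conclusion *)

(** Both gaps are now longest, so neither can be straddled; the left one is handled through the
    reflected set. *)
Lemma factors_eq rho lambda E q t : cantor3 rho lambda E ->
  2 * lambda = 1 - rho -> q != 0 -> `|q| < 1 ->
  self_embedding E q t -> factors rho lambda E q t.
Proof.
move=> cE gl q0 q1 emb; have [r0 r3 *] := cE.
have lr' : lambda < 1 - 2 * rho by lra.
have gle : 2 * lambda <= 1 - rho by lra.
have [le_lr|ge_r] := image_avoids_right_gap cE gle q0 q1 emb; last first.
  by apply: piece_factors => //; constructor 3.
have cE' := cantor3_reflect cE.
have gle' : 2 * (1 - rho - lambda) <= 1 - rho by lra.
have emb' : self_embedding [set x | E (1 - x)] q (1 - q - t).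
  by move=> x /emb; congr E; ring.
have refl x : E x -> E (1 - (1 - x)) by congr E; ring.
have [h|h] := image_avoids_right_gap cE' gle' q0 q1 emb';
  apply: piece_factors => //; [constructor 2|constructor 1] => x Ex;
  have := h _ (refl _ Ex); last by lra.
by have := le_lr _ Ex; lra.
Qed.

(** Conjugation by [x |-> 1 - x] swaps the outer letters, which is [rev_ord], and keeps the order of
    the word. *)
Lemma phi_word_reflect rho lambda (w : seq 'I_3) x :
  phi_word rho (1 - rho - lambda) w x =
  1 - phi_word rho lambda (map (@rev_ord 3) w) (1 - x).
Proof.
elim: w => [|i w IH] /=; first by ring.
by rewrite IH !phiE; case: i => -[|[|[|//]]] lti /=; ring.
Qed.

Lemma self_embedding_word_lt rho lambda E q t : cantor3 rho lambda E ->
  2 * lambda < 1 - rho -> q != 0 -> self_embedding E q t ->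
  exists w, forall x, q * x + t = phi_word rho lambda w x.
Proof.
move=> cE gl q0 emb; have [r0 r3 *] := cE.
have r1 : rho < 1 by lra.
have [n rn] : exists n, rho ^+ n < `|q|.
  by apply: exists_expr_lt; rewrite ?normr_gt0.
have [|w [wE|[emb1 _]]] := self_embedding_word cE _ (ltW rn) emb.
- by move=> q' t'; exact: factors_lt.
- by exists w.
- by case: (no_reflection cE gl emb1).
Qed.

End SelfEmbeddings.

Theorem theorem1p1 (R : realType) (rho lambda : R) (E : set R) (f : R -> R)
  (rho_gt0 : 0 < rho) (rho_lt : rho < 1 / 3)
  (lambda_ge : rho <= lambda) (lambda_le : lambda <= 1 - 2 * rho)
  (E_self_similar : is_self_similar_set (phi rho lambda) E)
  (f_similitude : contractive_similitude f)
  (f_sub : f @` E `<=` E) :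
  (lambda <> (1 - rho) / 2 ->
    exists w : seq 'I_3, forall x : R, f x = phi_word rho lambda w x) /\
  (lambda = (1 - rho) / 2 ->
    exists w : seq 'I_3,
      (forall x : R, f x = phi_word rho lambda w x) \/
      (forall x : R, f x = phi_word rho lambda w (1 - x))).
Proof.
have cE := self_similar_cantor3 rho_gt0 rho_lt lambda_ge lambda_le E_self_similar.
have [q [t [q0 q1 fE]]] := f_similitude.
rewrite normr_gt0 in q0.
have emb : self_embedding E q t.
  by move=> x Ex; apply: f_sub; exists x => //; rewrite fE.
split=> [neq|eq].
- have : 2 * lambda != 1 - rho by apply/eqP; lra.
  case: ltgtP => // gl _.
    have [w wE] := self_embedding_word_lt cE gl q0 emb.
    by exists w => x; rewrite fE.
  (* The left gap is longer: [f] is conjugated by the reflection, which keeps [q] and turns [t] into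
     [1 - q - t]. *)
  have emb' : self_embedding [set x | E (1 - x)] q (1 - q - t).
    by move=> x /emb; congr E; ring.
  have gl' : 2 * (1 - rho - lambda) < 1 - rho by lra.
  have [w wE] := self_embedding_word_lt (cantor3_reflect cE) gl' q0 emb'.
  exists (map (@rev_ord 3) w) => x; rewrite fE.
  by have := wE (1 - x); rewrite phi_word_reflect subKr; lra.
- have r1 : rho < 1 by lra.
  have [n rn] : exists n, rho ^+ n < `|q|.
    by apply: exists_expr_lt; rewrite ?normr_gt0.
  have [|w wE] := self_embedding_word cE _ (ltW rn) emb.
    move=> q' t' nq' q1' emb'; apply: factors_eq => //; first by lra.
    by rewrite -normr_gt0 (lt_le_trans _ nq')// exprn_gt0.
  by exists w; case: wE => [wE|[_ wE]]; [left|right] => x; rewrite fE.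
Qed.
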